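(* Let $X$ be a real Banach space, $Y$ a closed linear subspace of $X$, and let $\mathcal{A}(Y)$ be one of the families $\mathcal{F}(Y)$, $\mathcal{K}(Y)$, $\mathcal{B}(Y)$ of nonempty finite, nonempty compact, nonempty closed bounded subsets of $Y$, respectively. Let $F\in\mathcal{A}(Y)$, written as an indexed family $F=(y_i)_{i\in F}$. Suppose that for each continuous, monotone function $f:\ell_\infty(F)\to\mathbb{R}_{\geq 0}$ we have $\mathrm{rad}_Y^f(F)=\mathrm{rad}_X^f(F)$ and $X$ admits $f$-centers for $F$. Then the following are equivalent: (a) Whenever $r_i>0$ for $i\in F$ and $\bigcap_{i\in F}B_X(y_i,r_i)\neq\emptyset$, then $\bigcap_{i\in F}B_Y(y_i,r_i)\neq\emptyset$. (b) $Y$ admits restricted weighted Chebyshev centers for $F$ for all bounded weights $\rho:F\to\mathbb{R}_{>0}$. (c) $Y$ admits restricted $f$-centers for $F$ for all continuous, monotone functions $f:\ell_\infty(F)\to\mathbb{R}_{\geq 0}$.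
   Context: $B_X(a,r)$ (resp. $B_Y(a,r)$) is the closed ball of center $a$ and radius $r$ in $X$ (resp. $Y$). Sets are regarded as indexed by themselves; a finite set may be regarded as an ordered tuple $(y_1,\dots,y_n)$ with repetitions allowed, in which case $\ell_\infty(F)=\mathbb{R}^n_{\ge 0}$. $\ell_\infty(F)=\{\varphi:F\to\mathbb{R}_{\ge0}:\sup_{t\in F}\varphi(t)<\infty\}$ with the supremum norm and the pointwise order. A function $f:\ell_\infty(F)\to\mathbb{R}_{\ge0}$ is monotone if $\varphi_1\le\varphi_2$ implies $f(\varphi_1)\le f(\varphi_2)$. For $x\in X$ and a subspace $Z\subseteq X$ (in particular $Z=Y$ or $Z=X$): $r_f(x,F)=f\big((\|x-a\|)_{a\in F}\big)$, $\mathrm{rad}_Z^f(F)=\inf_{z\in Z}r_f(z,F)$, $\mathrm{Cent}_Z^f(F)=\{z\in Z: r_f(z,F)=\mathrm{rad}_Z^f(F)\}$. $X$ admits $f$-centers for $F$ if $\mathrm{Cent}_X^f(F)\ne\emptyset$; $Y$ admits restricted $f$-centers for $F$ if $\mathrm{Cent}_Y^f(F)\neq\emptyset$. For a bounded weight $\rho$ on $F$, $Y$ admits restricted weighted Chebyshev centers for $F$ for $\rho$ if $\mathrm{Cent}_Y^f(F)\ne\emptyset$ for $f(\varphi)=\sup_{t\in F}\rho(t)\varphi(t)$. *)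

(* Defs.v *)
From HB Require Import structures.
From mathcomp Require Import all_boot all_order all_algebra.
From mathcomp Require Import all_classical all_reals all_analysis.
Import Order.TTheory GRing.Theory Num.Theory.
Import numFieldNormedType.Exports.

Set Implicit Arguments.
Unset Strict Implicit.
Unset Printing Implicit Defensive.

Local Open Scope classical_set_scope.
Local Open Scope ring_scope.

(* The metric structure given to [linfty R I] below is the one of the supremum
   norm, so [continuous f] for f : linfty R I -> R is continuity for it. *)
Record linfty (R : realType) (I : Type) := Linfty {
  linfty_fun :> I -> R;
  linfty_ge0 : forall t, 0 <= linfty_fun t;
  linfty_bounded : has_ubound (range linfty_fun) }.

HB.instance Definition _ (R : realType) (I : Type) :=
  gen_eqMixin (linfty R I).
HB.instance Definition _ (R : realType) (I : Type) :=
  gen_choiceMixin (linfty R I).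

Definition linfty_dist (R : realType) (I : Type) (phi psi : linfty R I) : R :=
  sup (range (fun t => `|phi t - psi t|)).

Lemma linfty_eq (R : realType) (I : Type) (phi psi : linfty R I) :
  phi =1 psi -> phi = psi.
Proof.
case: phi psi => [p p0 pb] [q q0 qb] /= /funext epq; subst q.
by rewrite (Prop_irrelevance p0 q0) (Prop_irrelevance pb qb).
Qed.

Lemma linfty_dist_has_ubound (R : realType) (I : Type) (phi psi : linfty R I) :
  has_ubound (range (fun t => `|phi t - psi t|)).
Proof.
have [M HM] := linfty_bounded phi; have [N HN] := linfty_bounded psi.
exists (M + N) => _ [t _ <-].
apply: (le_trans (ler_normB _ _)).
by rewrite !ger0_norm ?linfty_ge0 // lerD //; [apply: HM|apply: HN]; exists t.
Qed.

Lemma linfty_dist_ub (R : realType) (I : Type) (phi psi : linfty R I) t :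
  `|phi t - psi t| <= linfty_dist phi psi.
Proof. by apply: ub_le_sup; [exact: linfty_dist_has_ubound|exists t]. Qed.

Lemma linfty_dist_ge0 (R : realType) (I : Type) (phi psi : linfty R I) :
  0 <= linfty_dist phi psi.
Proof.
have [e|/set0P[_ [t _ _]]] :=
    eqVneq (range (fun t => `|phi t - psi t|)) set0.
  by rewrite /linfty_dist e sup0.
exact: le_trans (normr_ge0 _) (linfty_dist_ub phi psi t).
Qed.

Lemma linfty_dist_le (R : realType) (I : Type) (phi psi : linfty R I) (M : R) :
  0 <= M -> (forall t, `|phi t - psi t| <= M) -> linfty_dist phi psi <= M.
Proof.
move=> M0 H; rewrite /linfty_dist.
have [->|/set0P ne] := eqVneq (range (fun t => `|phi t - psi t|)) set0.
  by rewrite sup0.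
by apply: ge_sup => // _ [t _ <-].
Qed.

Lemma linfty_distxx (R : realType) (I : Type) (phi : linfty R I) :
  linfty_dist phi phi = 0.
Proof.
apply/le_anti; rewrite linfty_dist_ge0 andbT.
by apply: (@linfty_dist_le R I phi phi 0) => // t; rewrite subrr normr0.
Qed.

Lemma linfty_dist_positivity (R : realType) (I : Type) (phi psi : linfty R I) :
  linfty_dist phi psi = 0 -> phi = psi.
Proof.
move=> d0; apply: linfty_eq => t; apply/eqP; rewrite -subr_eq0 -normr_le0 -d0.
exact: linfty_dist_ub.
Qed.

Lemma linfty_dist_sym (R : realType) (I : Type) (phi psi : linfty R I) :
  linfty_dist phi psi = linfty_dist psi phi.
Proof.
rewrite /linfty_dist; congr sup; apply: eq_imagel => t _.
exact: distrC.
Qed.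

Lemma linfty_dist_triangle (R : realType) (I : Type)
    (psi phi chi : linfty R I) :
  linfty_dist phi chi <= linfty_dist phi psi + linfty_dist psi chi.
Proof.
apply: linfty_dist_le => [|t]; first by rewrite addr_ge0 ?linfty_dist_ge0.
by apply: (le_trans (ler_distD (psi t) _ _)); rewrite lerD ?linfty_dist_ub.
Qed.

HB.instance Definition _ (R : realType) (I : Type) :=
  @isMetric.Build R (linfty R I) (@linfty_dist R I) (@linfty_distxx R I)
    (@linfty_dist_positivity R I) (@linfty_dist_sym R I)
    (@linfty_dist_triangle R I).

Definition linfty_monotone (R : realType) (I : Type) (f : linfty R I -> R) :=
  forall phi psi : linfty R I, (forall t, phi t <= psi t) -> f phi <= f psi.

(* The admissible f : l_oo(F) -> R_{>=0}; R_{>=0} is rendered as R together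
   with a sign condition. *)
Definition admissible (R : realType) (I : Type) (f : linfty R I -> R) :=
  [/\ forall phi, 0 <= f phi, continuous f & linfty_monotone f].

Definition weighted_sup (R : realType) (I : Type) (rho : I -> R)
    (phi : linfty R I) : R :=
  sup (range (fun t => rho t * phi t)).

Variant set_family := FiniteSets | CompactSets | ClosedBoundedSets.

(* As Y is assumed closed in X in the theorem, closedness (and compactness)
   in Y and in X agree for subsets of Y. *)
Definition in_family (R : realType) (X : completeNormedModType R)
    (A : set_family) (Y F : set X) : Prop :=
  [/\ F !=set0, F `<=` Y &
    match A with
    | FiniteSets => finite_set F
    | CompactSets => compact F
    | ClosedBoundedSets => closed F /\ bounded_set F
    end].

Lemma in_family_bounded (R : realType) (X : completeNormedModType R)
    (A : set_family) (Y F : set X) : in_family A Y F -> bounded_set F.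
Proof.
case=> _ _; case: A => [fF|cF|[]//]; apply: compact_bounded => //.
exact: finite_compact.
Qed.

(* A set is indexed by itself; a finite set may also be listed as a tuple,
   repetitions being allowed. *)
Variant indexing (R : realType) (X : completeNormedModType R) (F : set X) :=
| SelfIndexing
| TupleIndexing (n : nat) (y : n.-tuple X) of [set` y] = F.

Definition index_type (R : realType) (X : completeNormedModType R)
    (F : set X) (e : indexing F) : Type :=
  match e with
  | SelfIndexing => F
  | @TupleIndexing _ _ _ n _ _ => 'I_n
  end.

Definition indexed_pt (R : realType) (X : completeNormedModType R)
    (F : set X) (e : indexing F) : index_type e -> X :=
  match e with
  | SelfIndexing => fun t => set_val t
  | @TupleIndexing _ _ _ _ y _ => tnth y
  end.

Lemma range_indexed_pt (R : realType) (X : completeNormedModType R)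
    (F : set X) (e : indexing F) : range (@indexed_pt R X F e) = F.
Proof.
case: e => [|n y yF] /=.
  apply/seteqP; split=> [_ [t _ <-]|x Fx]; first exact: set_valP.
  by exists (SigSub (mem_set Fx)).
rewrite -[RHS]yF; apply/seteqP; split=> [_ [i _ <-]|x /= xy].
  exact: mem_tnth.
by have /tnthP[i ->] := xy; exists i.
Qed.

Lemma dist_vec_ge0 (R : realType) (X : completeNormedModType R) (F : set X)
    (e : indexing F) (x : X) (t : index_type e) : 0 <= `|x - indexed_pt t|.
Proof. exact: normr_ge0. Qed.

Lemma dist_vec_bounded (R : realType) (X : completeNormedModType R) (F : set X)
    (bF : bounded_set F) (e : indexing F) (x : X) :
  has_ubound (range (fun t : index_type e => `|x - indexed_pt t|)).
Proof.
have [M [_ HM]] := bF.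
exists (`|x| + (M + 1)) => _ [t _ <-].
apply: (le_trans (ler_normB _ _)); rewrite lerD2l.
apply: (HM (M + 1)); first by rewrite ltrDl.
have : range (@indexed_pt R X F e) (indexed_pt t) by exists t.
by rewrite range_indexed_pt.
Qed.

Definition dist_vec (R : realType) (X : completeNormedModType R) (F : set X)
    (bF : bounded_set F) (e : indexing F) (x : X) : linfty R (index_type e) :=
  Linfty (@dist_vec_ge0 R X F e x) (dist_vec_bounded bF e x).

Definition fradius_at (R : realType) (X : completeNormedModType R) (F : set X)
    (bF : bounded_set F) (e : indexing F) (f : linfty R (index_type e) -> R)
    (x : X) : R :=
  f (dist_vec bF e x).

Definition frad (R : realType) (X : completeNormedModType R) (F : set X)
    (bF : bounded_set F) (e : indexing F) (f : linfty R (index_type e) -> R)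
    (Z : set X) : R :=
  inf [set fradius_at bF f z | z in Z].

Definition fCent (R : realType) (X : completeNormedModType R) (F : set X)
    (bF : bounded_set F) (e : indexing F) (f : linfty R (index_type e) -> R)
    (Z : set X) : set X :=
  [set z | Z z /\ fradius_at bF f z = frad bF f Z].

Definition cball (R : realType) (X : completeNormedModType R) (Z : set X)
    (a : X) (r : R) : set X :=
  Z `&` closed_ball_ Num.norm a r.

(* Main.v *)
Require Import Defs.
From mathcomp Require Import all_boot all_order all_algebra.
From mathcomp Require Import all_classical all_reals all_analysis.
Import Order.TTheory GRing.Theory Num.Theory.
Import numFieldNormedType.Exports.

Local Open Scope classical_set_scope.
Local Open Scope ring_scope.

(** The three conditions compare, through the norm distances to the points
    [y_i], points of [X] with points of [Y].

    Condition on balls => [f]-centers ([ball_property_fCent]).  Let [x] be an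
    [f]-center in [X].  If [x] is one of the [y_i], it lies in [Y] already.
    Otherwise the radii [`|x - y_i|] are positive and the balls with these
    radii meet at [x], hence at some [y] of [Y].  This [y] is at least as close
    to every [y_i] as [x] is, so by monotonicity its [f]-radius is at most that
    of [x], which is the radius of [F] over [X], that is, over [Y].

    [f]-centers => weighted Chebyshev centers: a weighted supremum is monotone,
    and Lipschitz when the weights are bounded ([weighted_sup_admissible]).

    Weighted Chebyshev centers => condition on balls
    ([weighted_center_ball_property]).  Suppose that the balls of radii [r_i]
    meet at [x].  With the weights [1 / r_i], membership in all the balls means
    that the weighted radius is at most [1].  So the radius over [X], which is
    the radius over [Y], is at most [1], and a weighted center in [Y] lies in
    all the balls.  The weights are bounded unless the radii come arbitrarily
    close to [0]; in that case [x] is a limit of points [y_i], so it lies in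
    the closed set [Y] ([approached_by_indexed_pt]). *)

(** * Weighted suprema *)

Lemma weighted_sup_has_ubound {R : realType} {I : Type} (rho : I -> R)
    (rho0 : forall i, 0 <= rho i) (rhob : has_ubound (range rho))
    (phi : linfty R I) :
  has_ubound (range (fun t => rho t * phi t)).
Proof.
have [M HM] := rhob; have [N HN] := linfty_bounded phi.
exists (M * N) => _ [t _ <-].
by apply: ler_pM; rewrite ?linfty_ge0 //; [apply: HM|apply: HN]; exists t.
Qed.

Lemma weighted_sup_ub {R : realType} {I : Type} (rho : I -> R)
    (rho0 : forall i, 0 <= rho i) (rhob : has_ubound (range rho))
    (phi : linfty R I) (t : I) :
  rho t * phi t <= weighted_sup rho phi.
Proof. by apply: ub_le_sup; [exact: weighted_sup_has_ubound|exists t]. Qed.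

(** Over an empty [I] the supremum is [0], whence the condition [0 <= M]. *)
Lemma weighted_sup_le {R : realType} {I : Type} (rho : I -> R)
    (phi : linfty R I) (M : R) :
  0 <= M -> (forall t, rho t * phi t <= M) -> weighted_sup rho phi <= M.
Proof.
move=> M0 H; rewrite /weighted_sup.
have [->|/set0P ne] := eqVneq (range (fun t => rho t * phi t)) set0.
  by rewrite sup0.
by apply: ge_sup => // _ [t _ <-].
Qed.

Lemma weighted_sup_ge0 {R : realType} {I : Type} (rho : I -> R)
    (rho0 : forall i, 0 <= rho i) (rhob : has_ubound (range rho))
    (phi : linfty R I) :
  0 <= weighted_sup rho phi.
Proof.
have [e|/set0P[_ [t _ _]]] := eqVneq (range (fun t => rho t * phi t)) set0.
  by rewrite /weighted_sup e sup0.
apply: le_trans (weighted_sup_ub rho rho0 rhob phi t).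
by rewrite mulr_ge0 ?linfty_ge0.
Qed.

Lemma weighted_sup_monotone {R : realType} {I : Type} (rho : I -> R)
    (rho0 : forall i, 0 <= rho i) (rhob : has_ubound (range rho)) :
  linfty_monotone (weighted_sup (R := R) rho).
Proof.
move=> phi psi le_phi_psi.
apply: weighted_sup_le => [|t]; first exact: weighted_sup_ge0.
by apply: le_trans (weighted_sup_ub rho rho0 rhob psi t); exact: ler_wpM2l.
Qed.

Lemma weighted_sup_lipschitz {R : realType} {I : Type} (rho : I -> R)
    (rho0 : forall i, 0 <= rho i) (M : R) (M0 : 0 <= M)
    (rhoM : forall i, rho i <= M) (phi psi : linfty R I) :
  `|weighted_sup rho phi - weighted_sup rho psi| <= M * linfty_dist phi psi.
Proof.
have rhob : has_ubound (range rho) by exists M => _ [i _ <-].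
suff half (u v : linfty R I) :
    weighted_sup rho u - weighted_sup rho v <= M * linfty_dist u v.
  by rewrite ler_norml lerNl opprB half linfty_dist_sym half.
rewrite lerBlDr; apply: weighted_sup_le => [|t].
  by rewrite addr_ge0 ?mulr_ge0 ?linfty_dist_ge0 ?weighted_sup_ge0.
apply: (@le_trans _ _ (rho t * `|u t - v t| + rho t * v t)).
  by rewrite -mulrDr ler_wpM2l // -lerBlDr ler_norm.
by rewrite lerD ?weighted_sup_ub // ler_pM // linfty_dist_ub.
Qed.

Lemma weighted_sup_admissible {R : realType} {I : Type} (rho : I -> R)
    (rho0 : forall i, 0 <= rho i) (rhob : has_ubound (range rho)) :
  admissible (weighted_sup (R := R) rho).
Proof.
split; [exact: weighted_sup_ge0| |exact: weighted_sup_monotone].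
have [M HM] := rhob.
(* Replacing the bound [M] by [`|M| + 1] makes it positive, so that one can
   divide by it. *)
have N0 : 0 < `|M| + 1 by rewrite ltr_wpDl.
have rhoN i : rho i <= `|M| + 1.
  apply: (@le_trans _ _ M); first by apply: HM; exists i.
  by rewrite (le_trans (ler_norm M)) // lerDl.
move=> phi B /nbhs_ballP[eps /= eps0 epsB].
apply/nbhs_ballP; exists (eps / (`|M| + 1)); first by rewrite /= divr_gt0.
move=> psi; rewrite ballEmdist /= ltr_pdivlMr // mulrC => near_psi.
apply: epsB; rewrite -ball_normE /=; apply: le_lt_trans near_psi.
by apply: weighted_sup_lipschitz => //; exact: ltW.
Qed.

(** * Radii *)

Lemma frad_le {R : realType} {X : completeNormedModType R} {F : set X}
    (bF : bounded_set F) {e : indexing F} (f : linfty R (index_type e) -> R)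
    (f0 : forall phi, 0 <= f phi) (Z : set X) (z : X) :
  Z z -> frad bF f Z <= fradius_at bF f z.
Proof.
by move=> Zz; apply: ge_inf; [exists 0 => _ [w _ <-]; exact: f0|exists z].
Qed.

Lemma indexed_pt_in {R : realType} {X : completeNormedModType R}
    {F : set X} {e : indexing F} (i : index_type e) : F (indexed_pt i).
Proof. by rewrite -[X in X _](range_indexed_pt e); exists i. Qed.

Lemma approached_by_indexed_pt {R : realType} {X : completeNormedModType R}
    {Y F : set X} (Ycl : closed Y) (FY : F `<=` Y) {e : indexing F} (x : X) :
  (forall eps : R, 0 < eps ->
     exists i : index_type e, `|indexed_pt i - x| < eps) -> Y x.
Proof.
move=> approx; apply: Ycl => B /nbhs_ballP[eps /= eps0 epsB].
have [i ix] := approx _ eps0.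
exists (indexed_pt i); split; first exact/FY/indexed_pt_in.
by apply: epsB; rewrite -ball_normE /= distrC.
Qed.

(** * Balls and centers *)

(** The distances from a center in [X] to the points of [F] are themselves an
    admissible choice of radii, unless one of them vanishes; but then the center
    is a point of [F], hence of [Y]. *)
Lemma ball_property_fCent {R : realType} {X : completeNormedModType R}
    {Y F : set X} (F0 : F !=set0) (FY : F `<=` Y) (bF : bounded_set F)
    {e : indexing F} (f : linfty R (index_type e) -> R) (fadm : admissible f) :
  (forall r : index_type e -> R, (forall i, 0 < r i) ->
     \bigcap_i cball setT (indexed_pt i) (r i) !=set0 ->
     \bigcap_i cball Y (indexed_pt i) (r i) !=set0) ->
  frad bF f Y = frad bF f setT -> fCent bF f setT !=set0 ->
  fCent bF f Y !=set0.
Proof.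
move=> balls radE [x [_ xrad]]; have [f0 _ fmono] := fadm.
have [xpos|/existsNP[i /negP]] :=
    pselect (forall i : index_type e, 0 < `|x - indexed_pt i|).
- have [|y yballs] := balls _ xpos.
    by exists x => i _; split=> //; rewrite /closed_ball_ /= distrC.
  have [_ [i _ _]] : range (@indexed_pt R X F e) !=set0.
    by rewrite range_indexed_pt.
  have Yy : Y y by have [] := yballs i I.
  exists y; split=> //; apply/le_anti; rewrite frad_le // andbT radE -xrad.
  by apply: fmono => j; rewrite /= distrC; have [] := yballs j I.
- rewrite normr_gt0 negbK subr_eq0 => /eqP xE.
  by exists x; split; [rewrite xE; exact/FY/indexed_pt_in|rewrite radE].
Qed.

(** An intersection of balls of radii [r i] is a sublevel set, at level [1], of
    the radius for the weights [1 / r i].  Equality of the radii over [X] and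
    over [Y] makes this level reachable in [Y]. *)
Lemma weighted_center_ball_property {R : realType}
    {X : completeNormedModType R} {Y F : set X} (Ycl : closed Y)
    (FY : F `<=` Y) (bF : bounded_set F) {e : indexing F}
    (radE : forall f : linfty R (index_type e) -> R, admissible f ->
       frad bF f Y = frad bF f setT) :
  (forall rho : index_type e -> R, (forall i, 0 < rho i) ->
     has_ubound (range rho) -> fCent bF (weighted_sup rho) Y !=set0) ->
  forall r : index_type e -> R, (forall i, 0 < r i) ->
    \bigcap_i cball setT (indexed_pt i) (r i) !=set0 ->
    \bigcap_i cball Y (indexed_pt i) (r i) !=set0.
Proof.
move=> centers r r0 [x xr].
have [[eps eps0 rge]|rinf0] :=
    pselect (exists2 eps : R, 0 < eps & forall i, eps <= r i).
- pose rho i := (r i)^-1.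
  have rho0 i : 0 < rho i by rewrite invr_gt0.
  have rhoge0 i : 0 <= rho i by exact: ltW.
  have rhob : has_ubound (range rho).
    by exists eps^-1 => _ [i _ <-]; rewrite lef_pV2 ?posrE.
  have radm := weighted_sup_admissible rho rhoge0 rhob.
  have [y [Yy yrad]] := centers rho rho0 rhob.
  have ysup1 : weighted_sup rho (dist_vec bF e y) <= 1.
    rewrite -[leLHS]/(fradius_at bF (weighted_sup rho) y) yrad radE //.
    have [f0 _ _] := radm.
    apply: (le_trans (frad_le bF _ f0 setT x I)).
    apply: weighted_sup_le => // i.
    by rewrite mulrC ler_pdivrMr // mul1r /= distrC; have [] := xr i I.
  exists y => i _; split=> //; rewrite /closed_ball_ /= distrC.
  rewrite -[leRHS]mul1r -ler_pdivrMr //.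
  rewrite mulrC; apply: le_trans ysup1.
  exact: (weighted_sup_ub rho rhoge0 rhob (dist_vec bF e y) i).
  (* Balls of arbitrarily small radii contain [x], so their centers, which are
     points of [F], approach it. *)
- have Yx : Y x.
    apply: (@approached_by_indexed_pt _ _ _ _ Ycl FY e) => eps eps0.
    apply: contrapT => /forallNP far; apply: rinf0; exists eps => // i.
    have [_ /= xri] := xr i I.
    by rewrite (le_trans _ xri) // leNgt; apply/negP/far.
  by exists x => i _; split; [|have [] := xr i I].
Qed.

(** * The equivalence *)

Theorem theorem2p2 (R : realType) (X : completeNormedModType R)
    (Y : set X) (Ysub : submod_closed (mem Y)) (Ycl : closed Y)
    (A : set_family) (F : set X) (FA : in_family A Y F) (e : indexing F) :
  let bF : bounded_set F := in_family_bounded FA in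
  (forall f : linfty R (index_type e) -> R, admissible f ->
     frad bF f Y = frad bF f setT /\ fCent bF f setT !=set0) ->
  [<->
    (forall r : index_type e -> R, (forall i, 0 < r i) ->
       \bigcap_i cball setT (indexed_pt i) (r i) !=set0 ->
       \bigcap_i cball Y (indexed_pt i) (r i) !=set0);
    (forall rho : index_type e -> R, (forall i, 0 < rho i) ->
       has_ubound (range rho) ->
       fCent bF (weighted_sup rho) Y !=set0);
    (forall f : linfty R (index_type e) -> R, admissible f ->
       fCent bF f Y !=set0)].
Proof.
move=> bF H; have [F0 FY _] := FA.
have radE (f : linfty R (index_type e) -> R) (fadm : admissible f) :
    frad bF f Y = frad bF f setT.
  by have [] := H f fadm.
have ac (f : linfty R (index_type e) -> R) (fadm : admissible f) balls :=
  ball_property_fCent F0 FY bF f fadm balls (radE f fadm) (proj2 (H f fadm)).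
have weighted (rho : index_type e -> R) :
    (forall i, 0 < rho i) -> has_ubound (range rho) ->
    admissible (weighted_sup (R := R) rho).
  by move=> rho0; apply: weighted_sup_admissible => i; exact: ltW.
have ba := weighted_center_ball_property Ycl FY bF radE.
tfae.
- by move=> balls rho rho0 rhob; exact: ac (weighted rho rho0 rhob) balls.
- by move=> centers f fadm; exact: ac fadm (ba centers).
- by move=> fcenters; apply: ba => rho rho0 rhob; exact/fcenters/weighted.
Qed.
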